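(* Let $k$ be a positive integer, let $1<p<\frac{k+2}{k}$, and let $X_1=\frac{\partial}{\partial x_1}$ and $X_2=x_1^k\frac{\partial}{\partial x_2}$ on $\mathbb{R}^2$, with $X=(X_1,X_2)$. Let $u_0\in L^1_{\mathrm{loc}}(\mathbb{R}^2)$. If $f\in L^1_{\mathrm{loc}}(\mathbb{R}^2)$ with $\int_{\mathbb{R}^2}f(x)\,dx>0$, then the problem $u_t-\Delta_X u=|u|^p+f(x)$ in $(0,\infty)\times\mathbb{R}^2$, $u(0,x)=u_0(x)$, does not admit a global in time weak solution.
   Context: For a system $X=(X_1,\dots,X_m)$ of real $C^\infty$ vector fields, $\Delta_X=-\sum_{k=1}^m X_k^\ast X_k$ with $X_k^\ast=-X_k-\operatorname{div}X_k$; here the vector fields are divergence free, so $\Delta_X=X_1^2+X_2^2$. Weak solution (with $n=2$): for $f,u_0\in L^1_{\mathrm{loc}}(\mathbb{R}^n)$, a function $u\in L^p_{\mathrm{loc}}((0,T),L^p_{\mathrm{loc}}(\mathbb{R}^n))$ is a local in time weak solution (on $[0,T)$) of $u_t-\Delta_X u=|u|^p+f(x)$, $u(0,x)=u_0(x)$, if for every non-negative test function $\psi\in C^1_c([0,T);C^2_c(\mathbb{R}^n))$ one has $\int_0^T\!\int_{\mathbb{R}^n}|u|^p\psi+\int_{\mathbb{R}^n}u_0\psi(0,x)+\int_0^T\!\int_{\mathbb{R}^n}f\psi+\int_0^T\!\int_{\mathbb{R}^n}u\psi_t+\int_0^T\!\int_{\mathbb{R}^n}u\,\Delta_X\psi=0$.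 When $T=\infty$, such $u$ is called a global in time weak solution. *)

(* Defs.v *)
From HB Require Import structures.
From mathcomp Require Import all_boot all_order all_algebra.
From mathcomp Require Import all_classical all_reals all_analysis.

Set Implicit Arguments.
Unset Strict Implicit.
Unset Printing Implicit Defensive.

Import Order.TTheory GRing.Theory Num.Theory.
Import numFieldNormedType.Exports.

Local Open Scope classical_set_scope.
Local Open Scope ring_scope.

Notation leb1 R := (@lebesgue_measure R).

Notation leb2 R := (@lebesgue_measure R \x @lebesgue_measure R)%E.

Section Plane.
Context {R : realType}.
Implicit Types (phi : R * R -> R) (V : R * R -> R * R) (K : set (R * R)).

Definition d1 phi : R * R -> R := fun x => 'D_((1, 0) : R * R) phi x.

Definition d2 phi : R * R -> R := fun x => 'D_((0, 1) : R * R) phi x.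

(* A vector field [V] on the plane is given by its two coefficients; it acts on
   functions as the first-order operator [V.1 * d1 + V.2 * d2]. *)
Definition vf_apply V phi : R * R -> R :=
  fun x => (V x).1 * d1 phi x + (V x).2 * d2 phi x.

Definition vf_div V : R * R -> R :=
  fun x => d1 (fun y => (V y).1) x + d2 (fun y => (V y).2) x.

Definition vf_adj V phi : R * R -> R :=
  fun x => - vf_apply V phi x - vf_div V x * phi x.

Definition vf_laplacian (X : seq (R * R -> R * R)) phi : R * R -> R :=
  fun x => - \sum_(V <- X) vf_adj V (vf_apply V phi) x.

Definition is_C1 phi : Prop :=
  [/\ continuous phi,
      forall x, derivable phi x ((1, 0) : R * R),
      forall x, derivable phi x ((0, 1) : R * R),
      continuous (d1 phi) & continuous (d2 phi)].

Definition is_C2 phi : Prop := [/\ is_C1 phi, is_C1 (d1 phi) & is_C1 (d2 phi)].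

(* The Banach space of C^2 functions on the plane supported in [K]. *)
Definition C2_supp K phi : Prop :=
  is_C2 phi /\ forall x, ~ K x -> phi x = 0.

(* Convergence in C^2 norm: uniform convergence of all the partial derivatives
   of order at most 2. *)
Definition C2_cvg (F : set_system R) (g : R -> R * R -> R) phi : Prop :=
  [/\ {uniform, g @ F --> phi},
      {uniform, (fun s => d1 (g s)) @ F --> d1 phi},
      {uniform, (fun s => d2 (g s)) @ F --> d2 phi} &
   [/\ {uniform, (fun s => d1 (d1 (g s))) @ F --> d1 (d1 phi)},
      {uniform, (fun s => d1 (d2 (g s))) @ F --> d1 (d2 phi)},
      {uniform, (fun s => d2 (d1 (g s))) @ F --> d2 (d1 phi)} &
      {uniform, (fun s => d2 (d2 (g s))) @ F --> d2 (d2 phi)}]].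

Definition L1loc phi : Prop :=
  forall K, compact K -> (leb2 R).-integrable K (EFin \o phi).

End Plane.

Section WeakSolution.
Context {R : realType}.
Implicit Types (T : \bar R) (psi u : R -> R * R -> R) (f : R * R -> R).

Definition Itime T : set R := [set t | 0 <= t /\ (t%:E < T)%E].

Definition Otime T : set R := [set t | 0 < t /\ (t%:E < T)%E].

(* C^1_c([0,T); C^2_c): a C^1 curve, one-sided at 0, in the inductive limit of
   the spaces [C2_supp K], vanishing for times close to [T].  A compactly
   supported curve which is continuous for the inductive limit topology stays
   in a single [C2_supp K], and so does its derivative.  Values of [psi] at
   times outside [0,T) are irrelevant. *)
Definition test_function T psi : Prop :=
  exists (K : set (R * R)) (T0 : R) (dpsi : R -> R * R -> R),
    [/\ compact K, (T0%:E < T)%E,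
        forall t, Itime T t -> T0 < t -> psi t = cst 0 &
        forall t, Itime T t ->
          [/\ C2_supp K (psi t), C2_supp K (dpsi t),
              C2_cvg (within (Itime T) t^')
                (fun s x => (psi s x - psi t x) / (s - t)) (dpsi t) &
              C2_cvg (within (Itime T) (nbhs t)) dpsi (dpsi t)]].

(* L^p_loc((0,T); L^p_loc(R^2)), as functions jointly measurable in (t,x). *)
Definition Lploc T (p : R) u : Prop :=
  measurable_fun (Otime T `*` setT)
    (fun z : measurableTypeR R * (measurableTypeR R * measurableTypeR R) =>
       u z.1 z.2) /\
  forall (J : set R) (K : set (R * R)),
    compact J -> J `<=` Otime T -> compact K ->
    (\int[leb1 R]_(t in J) \int[leb2 R]_(x in K) (`|u t x| `^ p)%:E < +oo)%E.

(* Weak solutions on [0,T) of u_t - Delta_X u = |u|^p + f, u(0,.) = u0.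
   The integrals are extended-real valued and +oo - oo = -oo, so the sum can
   only be 0 if every integral in it is well defined and finite. *)
Definition weak_solution (X : seq (R * R -> R * R)) (p : R)
  f (u0 : R * R -> R) T u : Prop :=
  Lploc T p u /\
  forall psi, test_function T psi ->
    (forall t x, Itime T t -> 0 <= psi t x) ->
    (\int[leb1 R]_(t in Otime T) \int[leb2 R]_x (`|u t x| `^ p * psi t x)%:E
     + \int[leb2 R]_x (u0 x * psi 0 x)%:E
     + \int[leb1 R]_(t in Otime T) \int[leb2 R]_x (f x * psi t x)%:E
     + \int[leb1 R]_(t in Otime T) \int[leb2 R]_x
         (u t x * derive1 (psi ^~ x) t)%:E
     + \int[leb1 R]_(t in Otime T) \int[leb2 R]_x
         (u t x * vf_laplacian X (psi t) x)%:E = 0)%E.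

Definition global_weak_solution (X : seq (R * R -> R * R)) (p : R)
  f (u0 : R * R -> R) u : Prop :=
  weak_solution X p f u0 +oo%E u.

Definition grushin1 : R * R -> R * R := fun=> (1, 0).

Definition grushin2 (k : nat) : R * R -> R * R := fun x => (0, x.1 ^+ k).

End WeakSolution.

(* Main.v *)
Require Import Defs.
From HB Require Import structures.
From mathcomp Require Import all_boot all_order all_algebra.
From mathcomp Require Import all_classical all_reals all_analysis.
From mathcomp Require Import measurable_realfun ring lra.

(** Test the weak formulation against
    [psi t x = B_T t * B_r x.1 * B_(r^(k+1)) x.2], where
    [B_a s = max(0, 1 - (s/a)^2)^N]: this anisotropic box is the one adapted to
    the dilations of the Grushin operator, so that for [r^2 <= T] both [psi_t]
    and [Delta_X psi] are [O(r^-2)] times the power [(N-2)/N] of [psi].  If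
    [N >= 2p/(p-1)], Young's inequality absorbs the terms in [u] into
    [|u|^p psi] at the cost [O(r^(-2p/(p-1)))] times the volume [O(T r^(k+2))]
    of the box, whence
      [int u0 phi_r + c T (int f phi_r) <= C T r^(k+2-2p/(p-1))].
    Letting first [T] and then [r] tend to infinity contradicts [int f > 0],
    as [p < (k+2)/k] means exactly that the last exponent is negative. *)

Set Implicit Arguments.
Unset Strict Implicit.
Unset Printing Implicit Defensive.

Import Order.TTheory GRing.Theory Num.Theory.
Import numFieldNormedType.Exports.

Local Open Scope classical_set_scope.
Local Open Scope ring_scope.

(** * Derivatives of powers of the positive part and of products [g x.1 * h x.2] *)

Section Calculus.
Context {R : realType}.
Implicit Types (g : R -> R) (phi : R * R -> R).

(** In all four sign cases of [y] and [h + y], the first-order remainder is at most [h ^+ 2] in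
    absolute value, so the difference quotient is within [|h|] of its limit. *)
Lemma is_derive_pos_part_sqr (y : R) :
  is_derive y 1 (fun y : R => Num.max 0 y ^+ 2) (2 * Num.max 0 y).
Proof.
suff H : (fun h : R => h^-1 *: ((fun y : R => Num.max 0 y ^+ 2) (h *: 1 + y) -
    Num.max 0 y ^+ 2)) @ 0^' --> (2 * Num.max 0 y : R).
  by split; [apply/cvg_ex; exists (2 * Num.max 0 y)|apply/cvg_lim].
apply/cvgrPdist_le => e e0.
near=> h.
have h0 : h != 0 by near: h; exact: nbhs_dnbhs_neq.
have he : `|h| <= e.
  near: h. apply: dnbhs0_le. done.
rewrite /GRing.scale /= mulr1.
apply: le_trans he.
have -> : 2 * Num.max 0 y - h^-1 * (Num.max 0 (h + y) ^+ 2 - Num.max 0 y ^+ 2)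
  = - (h^-1 * (Num.max 0 (h + y) ^+ 2 - Num.max 0 y ^+ 2 - 2 * Num.max 0 y * h)).
  by field.
rewrite normrN normrM normfV ler_pdivrMl ?normr_gt0 // -normrM -expr2.
rewrite [leRHS]ger0_norm ?sqr_ge0 // ler_norml.
have [hy|hy] := leP 0 (h + y); have [yy|yy] := leP 0 y; apply/andP; split; nra.
Unshelve. all: by end_near. Qed.

(** The induction peels off a factor [y] instead of [max 0 y]: the two agree wherever the remaining
    power is nonzero, and [y] is differentiable at 0 whereas [max 0 y] is not. *)
Lemma is_derive_pos_part_pow n (y : R) :
  is_derive y 1 (fun y : R => Num.max 0 y ^+ n.+2)
    (n.+2%:R * Num.max 0 y ^+ n.+1).
Proof.
elim: n => [|n IH]; first by rewrite expr1; exact: is_derive_pos_part_sqr.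
have E : (fun y : R => Num.max 0 y ^+ n.+3) =
    (fun y : R => Num.max 0 y ^+ n.+2) * id.
  apply/funext => z; rewrite !fctE exprSr.
  by have [_|z0] := leP 0 z; rewrite // mulr0 expr0n mul0r.
rewrite E; apply: is_derive_eq.
transitivity (Num.max 0 y ^+ n.+2 * 1 +
  y * (n.+2%:R * Num.max 0 y ^+ n.+1)); first by [].
rewrite mulr1 mulrS [RHS]mulrDl mul1r; congr (_ + _).
rewrite mulrCA; congr (_ * _); rewrite [RHS]exprSr mulrC.
by have [_|y0] := leP 0 y; rewrite // mulr0 expr0n mul0r.
Qed.

Definition tensor g (h : R -> R) : R * R -> R := fun x => g x.1 * h x.2.

(** Along (1, 0) the factor [h x.2] is frozen, so the difference quotient is a one-variable one. *)
Lemma d1_tensor g (h : R -> R) x : derivable g x.1 1 ->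
  derivable (tensor g h) x ((1, 0) : R * R) /\
  d1 (tensor g h) x = 'D_1 g x.1 * h x.2.
Proof.
move=> dg.
have E : (fun s : R => s^-1 *: ((tensor g h \o shift x) (s *: ((1, 0) : R * R))
   - tensor g h x)) =
  (fun s : R => s^-1 *: (((fun a => g a * h x.2) \o shift x.1) (s *: 1)
   - g x.1 * h x.2)).
  apply/funext => s /=; congr (_ *: (_ - _)).
  by rewrite /tensor /= /GRing.scale /= mulr0 add0r.
have H : is_derive x.1 1 (fun a => g a * h x.2) ('D_1 g x.1 * h x.2).
  have -> : (fun a => g a * h x.2) = h x.2 \*: g.
    by apply/funext => a; rewrite /= mulrC.
  have := derivableP dg => dg'.
  by apply: is_derive_eq; rewrite /GRing.scale /= mulrC.
case: H => dH <-; split; first by rewrite /derivable E.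
by rewrite /d1 /derive E.
Qed.

Lemma d2_tensor g (h : R -> R) x : derivable h x.2 1 ->
  derivable (tensor g h) x ((0, 1) : R * R) /\
  d2 (tensor g h) x = g x.1 * 'D_1 h x.2.
Proof.
move=> dh.
have E : (fun s : R => s^-1 *: ((tensor g h \o shift x) (s *: ((0, 1) : R * R))
   - tensor g h x)) =
  (fun s : R => s^-1 *: (((fun a => g x.1 * h a) \o shift x.2) (s *: 1)
   - g x.1 * h x.2)).
  apply/funext => s /=; congr (_ *: (_ - _)).
  by rewrite /tensor /= /GRing.scale /= mulr0 add0r.
have H : is_derive x.2 1 (fun a => g x.1 * h a) (g x.1 * 'D_1 h x.2).
  have -> : (fun a => g x.1 * h a) = g x.1 \*: h by [].
  have := derivableP dh => dh'.
  exact: is_derive_eq.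
case: H => dH <-; split; first by rewrite /derivable E.
by rewrite /d2 /derive E.
Qed.

End Calculus.

(** * The polynomial cutoff: its derivatives and their bounds by lower powers *)

Section Cutoff.
Context {R : realType}.
Implicit Types (g h : R -> R).

(** It is of class C^2 from [n = 3] on, and its derivatives are controlled by lower powers of
    itself, which is what Young's inequality requires. For [n = 0] it is the constant 1, hence the
    successor exponents wherever its support matters. *)
Definition cutoff n (r s : R) : R := Num.max 0 (1 - (s / r) ^+ 2) ^+ n.

(* [cutoff1 n] and [cutoff2 n] are the derivatives of [cutoff n.+3]. *)
Definition cutoff1 n (r s : R) : R :=
  - (2 * n.+3%:R / r ^+ 2) * (s * cutoff n.+2 r s).

Definition cutoff2 n (r s : R) : R :=
  - (2 * n.+3%:R / r ^+ 2) *
  (cutoff n.+2 r s - 2 * n.+2%:R / r ^+ 2 * s ^+ 2 * cutoff n.+1 r s).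

Lemma is_derive_cutoff n (r s : R) :
  is_derive s 1 (cutoff n.+2 r) (- (2 * n.+2%:R / r ^+ 2) * (s * cutoff n.+1 r s)).
Proof.
have E : cutoff n.+2 r =
    (fun y : R => Num.max 0 y ^+ n.+2) \o (fun s => 1 - (s / r) ^+ 2) by [].
have H1 : is_derive s 1 (fun s : R => 1 - (s / r) ^+ 2) (- (2 * s / r ^+ 2)).
  have -> : (fun s : R => 1 - (s / r) ^+ 2) = cst 1 - (r ^- 2) \*: (fun x => x ^+ 2).
    by apply/funext => x; rewrite !fctE /= expr_div_n mulrC.
  apply: is_derive_eq; rewrite /GRing.scale /= sub0r; congr (- _).
  by rewrite mulr1 [RHS]mulrC mulr2n mulrDl mul1r.
rewrite E.
have := is_derive_pos_part_pow n (1 - (s / r) ^+ 2) => H2.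
apply: is_derive_eq; rewrite /GRing.scale /= /cutoff; ring.
Qed.

Lemma is_derive_cutoff0 n (r s : R) :
  is_derive s 1 (cutoff n.+3 r) (cutoff1 n r s).
Proof. exact: is_derive_cutoff. Qed.

Lemma is_derive_cutoff1 n (r s : R) :
  is_derive s 1 (cutoff1 n r) (cutoff2 n r s).
Proof.
have -> : cutoff1 n r = (- (2 * n.+3%:R / r ^+ 2)) \*: (id * cutoff n.+2 r).
  by [].
have := is_derive_cutoff n r s => H.
apply: is_derive_eq; rewrite /cutoff2.
transitivity (- (2 * n.+3%:R / r ^+ 2) *
  (s * (- (2 * n.+2%:R / r ^+ 2) * (s * cutoff n.+1 r s)) + cutoff n.+2 r s * 1)).
  by [].
by rewrite mulr1; congr (_ * _); ring.
Qed.

Lemma cutoff_ge0 n (r s : R) : 0 <= cutoff n r s.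
Proof. by rewrite exprn_ge0// le_max lexx. Qed.

Lemma cutoff_le1 n (r s : R) : cutoff n r s <= 1.
Proof.
rewrite exprn_ile1// ?le_max ?lexx// ge_max ler01 /=.
by rewrite gerBl sqr_ge0.
Qed.

Lemma cutoff_exp n m (r s : R) : cutoff n r s ^+ m = cutoff (n * m) r s.
Proof. by rewrite /cutoff exprM. Qed.

Lemma cutoff_antimono n m (r s : R) :
  (n <= m)%N -> cutoff m r s <= cutoff n r s.
Proof.
move=> nm; rewrite /cutoff ler_wiXn2l//; first by rewrite le_max lexx.
by have := cutoff_le1 1 r s; rewrite /cutoff expr1.
Qed.

Lemma cutoff_eq0 n (r s : R) : 0 < r -> r <= `|s| -> cutoff n.+1 r s = 0.
Proof.
move=> r0 rs; rewrite /cutoff max_l ?expr0n// subr_le0 -real_normK ?num_real//.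
by rewrite normrM normfV (gtr0_norm r0) exprn_ege1// ler_pdivlMr// mul1r.
Qed.

(** Inside the support [|s| < r] cancels one of the two factors [r] in the denominator; outside it
    both sides vanish. *)
Lemma normr_cutoff1_le n (r s : R) : 0 < r ->
  `|cutoff1 n r s| <= 2 * n.+3%:R / r * cutoff n.+2 r s.
Proof.
move=> r0; have [sr|rs] := leP r `|s|.
  by rewrite /cutoff1 !cutoff_eq0// !mulr0 normr0.
rewrite /cutoff1 normrM [`|s * _|]normrM normrN (ger0_norm (cutoff_ge0 n.+2 r s)) mulrA.
rewrite ler_wpM2r ?cutoff_ge0// [`|_ / _|]ger0_norm; last first.
  by rewrite divr_ge0// exprn_ge0// ltW.
have -> : 2 * n.+3%:R / r = 2 * n.+3%:R / r ^+ 2 * r by field; rewrite gt_eqF.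
by rewrite ler_wpM2l ?ltW// divr_gt0 ?mulr_gt0// exprn_gt0.
Qed.

(** Inside the support [s ^+ 2 / r ^+ 2 <= 1], so both terms of [cutoff2] are of order [r ^- 2]
    times the lower power [cutoff n.+1]. *)
Lemma normr_cutoff2_le n (r s : R) : 0 < r ->
  `|cutoff2 n r s| <= 4 * n.+3%:R ^+ 2 / r ^+ 2 * cutoff n.+1 r s.
Proof.
move=> r0; have [sr|rs] := leP r `|s|.
  by rewrite /cutoff2 !cutoff_eq0// ?mulr0 subr0 !mulr0 normr0.
have r2 : 0 < r ^+ 2 by rewrite exprn_gt0.
have c1 := cutoff_ge0 n.+1 r s; have c2 := cutoff_ge0 n.+2 r s.
have c12 : cutoff n.+2 r s <= cutoff n.+1 r s by exact: cutoff_antimono.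
have sr2 : s ^+ 2 / r ^+ 2 <= 1.
  rewrite ler_pdivrMr// mul1r -[s ^+ 2]real_normK ?num_real//.
  by rewrite lerXn2r ?nnegrE ?normr_ge0 ?(ltW r0) ?(ltW rs).
have sr0 : 0 <= s ^+ 2 / r ^+ 2 by rewrite divr_ge0 ?sqr_ge0.
rewrite /cutoff2 normrM normrN [`|_ / _|]ger0_norm; last first.
  by rewrite divr_ge0// exprn_ge0// ltW.
have -> : 4 * n.+3%:R ^+ 2 / r ^+ 2 * cutoff n.+1 r s =
  2 * n.+3%:R / r ^+ 2 * (2 * n.+3%:R * cutoff n.+1 r s) :> R.
  by field; exact: lt0r_neq0.
rewrite ler_wpM2l//; first by rewrite divr_ge0// exprn_ge0// ltW.
have -> : 2 * n.+2%:R / r ^+ 2 * s ^+ 2 * cutoff n.+1 r s =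
   2 * n.+2%:R * (s ^+ 2 / r ^+ 2 * cutoff n.+1 r s) by ring.
have b1 : s ^+ 2 / r ^+ 2 * cutoff n.+1 r s <= cutoff n.+1 r s by rewrite ler_piMl.
have b0 : 0 <= s ^+ 2 / r ^+ 2 * cutoff n.+1 r s by rewrite mulr_ge0.
have -> : n.+3%:R = 1 + n.+2%:R :> R by rewrite mulrS.
have : (0 : R) <= n.+2%:R by [].
move: (n.+2%:R : R) (cutoff n.+1 r s) (cutoff n.+2 r s)
  (s ^+ 2 / r ^+ 2 * cutoff n.+1 r s) c1 c2 c12 b1 b0 => N A B D.
by move=> *; rewrite ler_norml; apply/andP; split; nra.
Qed.

Lemma continuous_cutoff n (r : R) : continuous (cutoff n r).
Proof.
have -> : cutoff n r = (fun x => x ^+ n) \o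
    (fun s => Num.max ((cst 0 : R -> R) s) (1 - (r ^- 2) * s ^+ 2)).
  by apply/funext => s; rewrite /cutoff /= expr_div_n [_ / _]mulrC.
move=> s; apply: continuous_comp; last exact: exprn_continuous.
apply: continuous_max; first exact: cvg_cst.
apply: cvgB; first exact: cvg_cst.
apply: cvgM; first exact: cvg_cst.
exact: exprn_continuous.
Qed.

Lemma continuous_cutoff2 n (r : R) : continuous (cutoff2 n r).
Proof.
move=> s; apply: cvgM; first exact: cvg_cst.
apply: cvgB; first exact: continuous_cutoff.
apply: cvgM; last exact: continuous_cutoff.
apply: cvgM; first exact: cvg_cst.
exact: exprn_continuous.
Qed.

Lemma le_cutoff n (r r' s : R) : 0 < r -> r <= r' -> cutoff n r s <= cutoff n r' s.
Proof.
move=> r0 rr'; have r'0 : 0 < r' by rewrite (lt_le_trans r0).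
rewrite /cutoff; apply: lerXn2r.
- by rewrite nnegrE le_max lexx.
- by rewrite nnegrE le_max lexx.
rewrite ge_max le_max lexx /= le_max lerB ?orbT//.
rewrite !expr_div_n ler_wpM2l ?sqr_ge0// lef_pV2 ?posrE ?exprn_gt0//.
by rewrite lerXn2r ?nnegrE ?(ltW r0) ?(ltW r'0).
Qed.

End Cutoff.

(** * Products of bounded C^2 functions of one variable, and convergence in C^2 norm *)

Section TestFunctions.
Context {R : realType}.
Implicit Types (g h : R -> R) (phi : R * R -> R).

(** The common bound on the function and its two derivatives is what turns convergence of a scalar
    coefficient into uniform convergence of every partial derivative of a product. *)
Record C2_bounded g g1 g2 (M : R) : Prop := C2Bounded {
  C2b_derive : forall s : R, is_derive s 1 g (g1 s);
  C2b_derive1 : forall s : R, is_derive s 1 g1 (g2 s);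
  C2b_cont : continuous g2;
  C2b_le : forall s, `|g s| <= M;
  C2b_le1 : forall s, `|g1 s| <= M;
  C2b_le2 : forall s, `|g2 s| <= M }.

Lemma C2_bounded_cutoff n (r : R) : 0 < r -> exists M,
  C2_bounded (cutoff n.+3 r) (cutoff1 n r) (cutoff2 n r) M.
Proof.
move=> r0; pose M1 := 2 * n.+3%:R / r : R.
pose M2 := 4 * n.+3%:R ^+ 2 / r ^+ 2 : R.
have M1_ge0 : 0 <= M1 by rewrite divr_ge0// ltW.
have M2_ge0 : 0 <= M2 by rewrite divr_ge0 ?mulr_ge0 ?exprn_ge0// ltW.
exists (1 + M1 + M2); split.
- exact: is_derive_cutoff0.
- exact: is_derive_cutoff1.
- exact: continuous_cutoff2.
- move=> s; rewrite ger0_norm ?cutoff_ge0// (le_trans (cutoff_le1 _ _ _))//.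
  by rewrite -addrA lerDl addr_ge0.
- move=> s; rewrite (le_trans (normr_cutoff1_le n s r0))//.
  rewrite (@le_trans _ _ M1)//; first by rewrite ler_piMr// cutoff_le1.
  by lra.
- move=> s; rewrite (le_trans (normr_cutoff2_le n s r0))//.
  rewrite (@le_trans _ _ M2)//; first by rewrite ler_piMr// cutoff_le1.
  by lra.
Qed.

Lemma is_derive_continuous g g1 : (forall s : R, is_derive s 1 g (g1 s)) ->
  continuous g.
Proof.
move=> dg s; apply: differentiable_continuous; apply/derivable1_diffP.
by have [] := dg s.
Qed.

Lemma continuous_tensor g h : continuous g -> continuous h ->
  continuous (tensor g h).
Proof.
move=> cg ch x; apply: cvgM.
- by apply: (@continuous_comp _ _ _ fst g); [exact: cvg_fst|exact: cg].
- by apply: (@continuous_comp _ _ _ snd h); [exact: cvg_snd|exact: ch].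
Qed.

Lemma derive_tensor g g1 h h1 :
    (forall s : R, is_derive s 1 g (g1 s)) ->
    (forall s : R, is_derive s 1 h (h1 s)) ->
  [/\ d1 (tensor g h) = tensor g1 h, d2 (tensor g h) = tensor g h1,
    forall x, derivable (tensor g h) x ((1, 0) : R * R) &
    forall x, derivable (tensor g h) x ((0, 1) : R * R)].
Proof.
move=> dg dh.
have G x := @d1_tensor _ g h x (@ex_derive _ _ _ _ _ _ _ (dg x.1)).
have H x := @d2_tensor _ g h x (@ex_derive _ _ _ _ _ _ _ (dh x.2)).
split; [apply/funext|apply/funext| |] => x.
- by rewrite (G x).2 derive_val.
- by rewrite (H x).2 derive_val.
- exact: (G x).1.
- exact: (H x).1.
Qed.

Lemma is_C1_tensor g g1 h h1 :
    (forall s : R, is_derive s 1 g (g1 s)) ->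
    (forall s : R, is_derive s 1 h (h1 s)) ->
    continuous g1 -> continuous h1 ->
  is_C1 (tensor g h).
Proof.
move=> dg dh cg1 ch1; have [e1 e2 D1 D2] := derive_tensor dg dh.
have cg := is_derive_continuous dg; have ch := is_derive_continuous dh.
by split; rewrite ?e1 ?e2//; exact: continuous_tensor.
Qed.

Lemma is_C2_tensor g g1 g2 h h1 h2 M N :
  C2_bounded g g1 g2 M -> C2_bounded h h1 h2 N -> is_C2 (tensor g h).
Proof.
move=> [dg dg1 cg2 _ _ _] [dh dh1 ch2 _ _ _].
have [e1 e2 _ _] := derive_tensor dg dh.
have cg1 := is_derive_continuous dg1; have ch1 := is_derive_continuous dh1.
by split; [|rewrite e1|rewrite e2]; apply: is_C1_tensor; eassumption.
Qed.

Lemma C2_bounded_scale g g1 g2 M (c : R) : C2_bounded g g1 g2 M ->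
  C2_bounded (c \*: g) (c \*: g1) (c \*: g2) (`|c| * M).
Proof.
move=> [dg dg1 cg2 Mg Mg1 Mg2].
split.
- by move=> s; have := dg s => H; apply: is_deriveZ.
- by move=> s; have := dg1 s => H; apply: is_deriveZ.
- by move=> s; apply: cvgM; [exact: cvg_cst|exact: cg2].
all: by move=> s /=; rewrite normrM ler_wpM2l.
Qed.

Lemma uniform_cvg_scale (F : set_system R) (c : R -> R) (c0 M : R) phi :
    Filter F -> (forall x, `|phi x| <= M) -> c @ F --> c0 ->
  {uniform, (fun s x => c s * phi x) @ F --> (fun x => c0 * phi x)}.
Proof.
move=> FF Mphi /cvgrPdist_lt cc; have M0 : 0 <= M by rewrite (le_trans _ (Mphi 0)).
move=> P /uniform_nbhs[E [entE EP]].
suff H : \forall s \near F, forall y, E (c0 * phi y, c s * phi y).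
  by apply: (@filterS _ F FF _ _ _ H) => s Hs; apply: EP => y _; exact: Hs.
move: entE; rewrite -entourage_ballE => -[e /= e0 eE].
(* The denominator is [M + 1] because [M] may be 0. *)
have : \forall s \near F, `|c0 - c s| < e / (M + 1).
  by apply: cc; rewrite divr_gt0// ltr_wpDl.
apply: filterS => s cs y; apply: eE.
rewrite /ball /= -mulrBl normrM.
have M1 : 0 < M + 1 by rewrite ltr_wpDl.
rewrite ltr_pdivlMr// in cs; apply: le_lt_trans cs.
by rewrite ler_wpM2l// (le_trans (Mphi y))// lerDl.
Qed.

(** Each partial derivative of [c s * tensor g h] is [c s] times a fixed bounded product, so all
    seven convergences are instances of [uniform_cvg_scale]. *)
Lemma C2_cvg_scale (F : set_system R) (c : R -> R) (c0 M N : R) g g1 g2 h h1 h2 :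
    Filter F -> C2_bounded g g1 g2 M -> C2_bounded h h1 h2 N ->
    c @ F --> c0 ->
  C2_cvg F (fun s x => c s * tensor g h x) (fun x => c0 * tensor g h x).
Proof.
move=> FF bg bh cc.
(* The scalar is absorbed into the first factor, so that [derive_tensor] applies to the scaled
   function. *)
have E (a : R) (g' h' : R -> R) :
    (fun x => a * tensor g' h' x) = tensor (a \*: g') h'.
  by apply/funext => x; rewrite /tensor /= mulrA.
have Mt (g' h' : R -> R) : (forall s, `|g' s| <= M) -> (forall s, `|h' s| <= N) ->
    forall x, `|tensor g' h' x| <= M * N.
  by move=> Mg Nh x; rewrite /tensor normrM ler_pM.
have D (a : R) : [/\ d1 (tensor (a \*: g) h) = tensor (a \*: g1) h,
   d2 (tensor (a \*: g) h) = tensor (a \*: g) h1,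
   d1 (tensor (a \*: g1) h) = tensor (a \*: g2) h,
   d2 (tensor (a \*: g1) h) = tensor (a \*: g1) h1 &
   d1 (tensor (a \*: g) h1) = tensor (a \*: g1) h1 /\
   d2 (tensor (a \*: g) h1) = tensor (a \*: g) h2].
  have [dg dg1 _ _ _ _] := C2_bounded_scale a bg; have [dh dh1 _ _ _ _] := bh.
  have [-> -> _ _] := derive_tensor dg dh.
  have [-> -> _ _] := derive_tensor dg1 dh.
  by have [-> -> _ _] := derive_tensor dg dh1.
have D1 : (fun s => d1 (fun x => c s * tensor g h x)) =
    (fun s x => c s * tensor g1 h x).
  by apply/funext => s; rewrite !E; have [] := D (c s).
have D2 : (fun s => d2 (fun x => c s * tensor g h x)) =
    (fun s x => c s * tensor g h1 x).
  by apply/funext => s; rewrite !E; have [] := D (c s).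
have [Mg Mg1 Mg2] : [/\ forall s, `|g s| <= M, forall s, `|g1 s| <= M &
   forall s, `|g2 s| <= M] by case: bg.
have [Nh Nh1 Nh2] : [/\ forall s, `|h s| <= N, forall s, `|h1 s| <= N &
   forall s, `|h2 s| <= N] by case: bh.
have key (G : R -> R * R -> R) g' h' : (forall s, `|g' s| <= M) ->
    (forall s, `|h' s| <= N) ->
    (forall a, G a = tensor (a \*: g') h') ->
    {uniform, (G \o c) @ F --> (G c0 : R * R -> R)}.
  move=> bg' bh' HG.
  have -> : G \o c = (fun s x => c s * tensor g' h' x).
    by apply/funext => s; rewrite /= HG E.
  by rewrite HG -E; apply: (@uniform_cvg_scale _ _ _ (M * N)) => //; exact: Mt.
pose A (a : R) := fun x => a * tensor g h x.
split; [| | |split].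
- by apply: (key A g h) => // a; rewrite /A E.
- by apply: (key (d1 \o A) g1 h) => // a; rewrite /= /A E; have [] := D a.
- by apply: (key (d2 \o A) g h1) => // a; rewrite /= /A E; have [] := D a.
- apply: (key (d1 \o d1 \o A) g2 h) => // a; rewrite /= /A E.
  by have [-> _ -> _ _] := D a.
- apply: (key (d1 \o d2 \o A) g1 h1) => // a; rewrite /= /A E.
  by have [_ -> _ _ [-> _]] := D a.
- apply: (key (d2 \o d1 \o A) g1 h1) => // a; rewrite /= /A E.
  by have [-> _ _ -> _] := D a.
- apply: (key (d2 \o d2 \o A) g h2) => // a; rewrite /= /A E.
  by have [_ -> _ _ [_ ->]] := D a.
Qed.

End TestFunctions.

(** * Admissibility of separated test functions, and the Grushin operator on them *)

Section TestFunctions.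
Context {R : realType}.
Implicit Types (g h : R -> R) (phi : R * R -> R).

(** This is the derivative after the substitution [s = t + h], the form used by [test_function]. *)
Lemma cvg_slope g (g1 t : R) : is_derive t 1 g g1 ->
  ((g s - g t) / (s - t)) @[s --> t^'] --> g1.
Proof.
move=> [dg <-]; move/cvgrPdist_lt : (dg) => H.
apply/cvgrPdist_lt => e e0.
have /nbhs_ballP[d /= d0 Hd] := H e e0.
apply/nbhs_ballP; exists d => //= s sd st.
have := Hd (s - t); rewrite /ball /= sub0r opprB => /(_ sd).
rewrite subr_eq0 => /(_ st); rewrite /GRing.scale /= mulr1 subrK.
by rewrite [_^-1 * _]mulrC.
Qed.

(** The spatial profile is fixed, so differentiating the curve in the C^2 norm amounts to
    differentiating the scalar [eta]. *)
Lemma test_function_tensor (a b T : R) eta eta1 eta2 g g1 g2 h h1 h2 K M N :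
    C2_bounded eta eta1 eta2 K -> C2_bounded g g1 g2 M ->
    C2_bounded h h1 h2 N ->
    (forall t, T < t -> eta t = 0) ->
    (forall s, a < `|s| -> g s = 0) -> (forall s, b < `|s| -> h s = 0) ->
  test_function +oo (fun t x => eta t * tensor g h x).
Proof.
move=> beta bg bh eta0 g0 h0.
exists ([set` `[- a, a]%R] `*` [set` `[- b, b]%R]), T,
  (fun t x => eta1 t * tensor g h x).
have supp (c : R) : C2_supp ([set` `[- a, a]%R] `*` [set` `[- b, b]%R])
    (fun x => c * tensor g h x).
  split.
    have -> : (fun x => c * tensor g h x) = tensor (c \*: g) h.
      by apply/funext => x; rewrite /tensor /= mulrA.
    by apply: is_C2_tensor; [exact: C2_bounded_scale bg|exact: bh].
  move=> x Kx; rewrite /tensor.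
  have [xa|xa] := leP `|x.1| a; last by rewrite g0// mul0r mulr0.
  have [xb|xb] := leP `|x.2| b; last by rewrite h0// !mulr0.
  by exfalso; apply: Kx; split; rewrite /= in_itv /= -ler_norml.
split.
- by apply: compact_setX; exact: segment_compact.
- by rewrite ltry.
- by move=> t _ Tt; apply/funext => x; rewrite eta0// mul0r.
move=> t It; split; [exact: supp|exact: supp| |].
- have -> : (fun s x => (eta s * tensor g h x - eta t * tensor g h x) / (s - t)) =
      (fun s x => ((eta s - eta t) / (s - t)) * tensor g h x).
    by apply/funext => s; apply/funext => x; rewrite -mulrBl mulrAC.
  apply: C2_cvg_scale bg bh _.
  (* [eta] lives on the whole line: its two-sided derivative restricts to [Itime], giving the
     one-sided one at 0. *)
  apply: cvg_within_filter; apply: cvg_slope.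
  by case: beta.
- apply: C2_cvg_scale bg bh _; apply: cvg_within_filter.
  by case: beta => _ de1 _ _ _ _; exact: (is_derive_continuous de1).
Qed.

(** Both fields are divergence free, so the operator is the sum of their squares; the coefficient
    [x.1 ^+ k] commutes with [d2] and therefore comes out twice. *)
Lemma vf_laplacian_grushin k (c M N : R) g g1 g2 h h1 h2 x :
    C2_bounded g g1 g2 M -> C2_bounded h h1 h2 N ->
  vf_laplacian [:: grushin1; grushin2 k] (fun x => c * tensor g h x) x =
  c * (g2 x.1 * h x.2 + x.1 ^+ k * x.1 ^+ k * (g x.1 * h2 x.2)).
Proof.
move=> bg bh.
have -> : (fun x => c * tensor g h x) = tensor (c \*: g) h.
  by apply/funext => y; rewrite /tensor /= mulrA.
have [dg dg1 _ _ _ _] := C2_bounded_scale c bg; have [dh dh1 _ _ _ _] := bh.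
have [e1 e2 _ _] := derive_tensor dg dh.
have [e11 _ _ _] := derive_tensor dg1 dh.
have A1 : vf_apply grushin1 (tensor (c \*: g) h) = tensor (c \*: g1) h.
  by apply/funext => y; rewrite /vf_apply /= mul1r mul0r addr0 e1.
have A2 : vf_apply (grushin2 k) (tensor (c \*: g) h) =
    tensor (fun s => s ^+ k * (c \*: g) s) h1.
  by apply/funext => y; rewrite /vf_apply /= mul0r add0r e2 /tensor /= mulrA.
have cst0 (a : R) : d1 (cst a) = cst 0 /\ d2 (cst a) = cst 0.
  by split; apply/funext => y; rewrite /d1 /d2 derive_cst.
have div1 y : vf_div (R := R) grushin1 y = 0.
  rewrite /vf_div /grushin1 /=.
  by rewrite -/(cst 1) -/(cst 0) (cst0 1).1 (cst0 0).2 addr0.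
have div2 y : vf_div (R := R) (grushin2 k) y = 0.
  rewrite /vf_div /grushin2 /= -/(cst 0) (cst0 0).1.
  have -> : (fun y : R * R => y.1 ^+ k) = tensor (fun s => s ^+ k) (cst 1).
    by apply/funext => z; rewrite /tensor /= mulr1.
  have [_ ->] := @d2_tensor R (fun s => s ^+ k) (cst 1) y (derivable_cst _ _ _).
  by rewrite derive_cst mulr0 addr0.
have D2 : d2 (tensor (fun s => s ^+ k * (c \*: g) s) h1) x =
    x.1 ^+ k * (c * g x.1) * h2 x.2.
  have := @d2_tensor R (fun s => s ^+ k * (c \*: g) s) h1 x
    (@ex_derive _ _ _ _ _ _ _ (dh1 x.2)).
  by move=> [_ ->]; rewrite derive_val.
rewrite /vf_laplacian !big_cons big_nil addr0 /vf_adj div1 div2 !mul0r !subr0.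
rewrite A1 A2 {1}/vf_apply /= e11 mul1r mul0r addr0.
by rewrite /vf_apply /= D2 /tensor /= /GRing.scale /=; ring.
Qed.

End TestFunctions.

(** * Comparison of integrals, and sigma-finiteness of the plane *)

Section Integration.
Local Open Scope ereal_scope.

Section GeneralMeasure.
Context d (T : measurableType d) (R : realType) (mu : {measure set T -> \bar R}).

(* The measurability of the inner integrals of [u * psi_t] and
   [u * Delta_X psi] in time is thus never needed. *)
Lemma ge0_le_integral_nonmeasurable (D : set T) (f g : T -> \bar R) :
    (forall x, D x -> 0 <= f x) -> (forall x, D x -> f x <= g x) ->
  \int[mu]_(x in D) f x <= \int[mu]_(x in D) g x.
Proof.
(* Each side is a supremum over the simple functions below its integrand, and those below [f] are
   also below [g]. *)
move=> f0 fg; rewrite !(integral_mkcond D) !ge0_integralTE.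
- apply: ereal_sup_le => _ [h /= hf <-]; exists h => // x.
  by rewrite (le_trans (hf x))// lee_restrict.
- by apply: erestrict_ge0 => x Dx; rewrite (le_trans (f0 x Dx))// fg.
- exact: erestrict_ge0.
Qed.

(** The negative part of [f] lies below [g], and the integral of the positive part can only raise
    the left-over difference. *)
Lemma integral_ge_opp (D : set T) (f g : T -> \bar R) :
    (forall x, D x -> 0 <= g x) -> (forall x, D x -> - g x <= f x) ->
  - (\int[mu]_(x in D) g x) <= \int[mu]_(x in D) f x.
Proof.
move=> g0 gf; rewrite (integralE _ _ f).
have neg : \int[mu]_(x in D) f^\- x <= \int[mu]_(x in D) g x.
  apply: ge0_le_integral_nonmeasurable => x Dx; first exact: funeneg_ge0.
  by rewrite funenegE ge_max leeNl gf//= g0.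
have pos : 0 <= \int[mu]_(x in D) f^\+ x.
  by apply: integral_ge0 => x _; exact: funepos_ge0.
apply: (@le_trans _ _ (- (\int[mu]_(x in D) f^\- x))); first by rewrite leeN2.
exact: leeDr.
Qed.

End GeneralMeasure.

Context {R : realType}.
Local Notation plane := (measurableTypeR R * measurableTypeR R)%type.

Definition square (n : nat) : set plane :=
  [set` `[(- n%:R)%R, n%:R]] `*` [set` `[(- n%:R)%R, n%:R]].

Lemma measurable_square n : measurable (square n).
Proof. by apply: measurableX; exact: measurable_itv. Qed.

Lemma bigcup_square : \bigcup_n square n = setT.
Proof.
apply/seteqP; split => // x _.
pose M : R := Num.max `|x.1 : R|%R `|x.2 : R|%R.
exists (Num.bound M) => //.
have H : (M <= (Num.bound M)%:R)%R.
  by apply/ltW/archi_boundP; rewrite le_max normr_ge0.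
split; rewrite /= in_itv /= -ler_norml (le_trans _ H)// le_max lexx ?orbT//.
Qed.

Lemma sigma_finite_leb2 : sigma_finite [set: plane] (leb2 R).
Proof.
exists square; first by rewrite bigcup_square.
move=> n; split; first exact: measurable_square.
rewrite product_measure1E//; do ?exact: measurable_itv.
by apply: lte_mul_pinfty => //=; rewrite lebesgue_measure_itv /=; case: ifP;
  rewrite // ?fin_num_fun -?EFinB ?ltry.
Qed.

(* The canonical sigma-finite structure of [\x] is shadowed by the one for
   products of subprobabilities, hence this copy. *)
Definition plane_measure : set plane -> \bar R := leb2 R.

HB.instance Definition _ := Measure.copy plane_measure (leb2 R).
HB.instance Definition _ := Measure_isSigmaFinite.Build _ _ _ plane_measure
  sigma_finite_leb2.

Lemma measurable_integral_plane
    (f : measurableTypeR R * plane -> \bar R) :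
    measurable_fun setT f -> (forall z, 0 <= f z) ->
  measurable_fun setT (fun t => \int[leb2 R]_x f (t, x)).
Proof.
exact: (@measurable_fun_fubini_tonelli_F _ _ _ _ R plane_measure).
Qed.

End Integration.

(** * Absorption of the terms in [u] by the integral of [|u|^p psi] *)

Section Energy.
Local Open Scope ereal_scope.
Context {R : realType}.
Local Notation plane := (measurableTypeR R * measurableTypeR R)%type.

Lemma Otime_itv : Otime (+oo : \bar R) = [set` `]0%R, +oo[].
Proof.
apply/seteqP; split=> t; rewrite /Otime /= in_itv /= andbT.
  by case.
by move=> t0; split => //; rewrite ltry.
Qed.

Lemma measurable_Otime : measurable (Otime (+oo : \bar R) : set (measurableTypeR R)).
Proof. by rewrite Otime_itv; exact: measurable_itv. Qed.

(** The integrand is the majorant furnished by Young's inequality: half of the energy density plus a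
    constant on a space-time box. *)
Lemma integral_half_add_box (F : R -> plane -> R) (c a V : R) (K : set plane) :
    measurable_fun (Otime +oo `*` setT)
      (fun z : measurableTypeR R * plane => F z.1 z.2) ->
    (forall t x, (0 < t)%R -> (0 <= F t x)%R) ->
    (0 <= c)%R -> (0 <= a)%R -> measurable K -> leb2 R K = V%:E ->
  \int[leb1 R]_(t in Otime +oo) \int[leb2 R]_x
    (2^-1 * F t x + c * (\1_(`[0%R, a]) t * \1_K x))%:E =
  (2^-1)%:E * (\int[leb1 R]_(t in Otime +oo) \int[leb2 R]_x (F t x)%:E)
  + (c * a * V)%:E.
Proof.
move=> mF F0 c0 a0 mK KV.
have mO := measurable_Otime.
(* [F] is measurable only for positive times; its extension by 0 is measurable everywhere, as
   Tonelli's theorem demands. *)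
pose G : measurableTypeR R * plane -> \bar R :=
  (fun z => (F z.1 z.2)%:E) \_ (Otime +oo `*` setT).
have mOT : measurable (Otime +oo `*` setT : set (measurableTypeR R * plane)).
  by apply: measurableX.
have mG : measurable_fun setT G.
  by apply: (measurable_restrictT _ mOT).1; exact/measurable_EFinP.
have G0 z : 0 <= G z.
  by apply: erestrict_ge0 => -[t x] [/= [t0 _] _]; rewrite lee_fin F0.
have GF t x : Otime +oo t -> G (t, x) = (F t x)%:E.
  by move=> Ot; rewrite /G patchE mem_set.
have mF_ t : Otime +oo t -> measurable_fun setT (fun x => (F t x)%:E).
  move=> Ot; apply: (eq_measurable_fun (fun x => G (t, x))).
    by move=> x _; rewrite GF.
  exact: measurable_fun_pair2.
have V0 : (0 <= V)%R by rewrite -lee_fin -KV measure_ge0.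
have H t : Otime +oo t -> \int[leb2 R]_x
    (2^-1 * F t x + c * (\1_(`[0%R, a]) t * \1_K x))%:E =
    (2^-1)%:E * (\int[leb2 R]_x G (t, x)) + (c * V)%:E * (\1_(`[0%R, a]) t)%:E.
  move=> Ot.
  under eq_integral do rewrite EFinD [((2^-1 * _)%R)%:E]EFinM mulrA
    [((c * _ * _)%R)%:E]EFinM.
  have t0 : (0 < t)%R by case: Ot.
  rewrite ge0_integralD//; last 4 first.
  - by move=> x _; rewrite mule_ge0// lee_fin F0.
  - by apply: measurable_funeM; exact: mF_.
  - by move=> x _; rewrite mule_ge0// lee_fin ?mulr_ge0// indicE ler0n.
  - apply: measurable_funeM; apply/measurable_EFinP.
    exact: measurable_indic.
  rewrite ge0_integralZl_EFin//; last 2 first.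
  - by move=> x _; rewrite lee_fin F0.
  - exact: mF_.
  rewrite ge0_integralZl_EFin//; last 2 first.
  - apply/measurable_EFinP; exact: measurable_indic.
  - by rewrite mulr_ge0// indicE ler0n.
  rewrite (etrans _ KV : \int[leb2 R]_x (\1_K x)%:E = V%:E); last first.
    by rewrite integral_indic// setIT.
  congr (_ + _).
    by congr (_ * _); apply: eq_integral => x _; rewrite GF.
  by rewrite -!EFinM mulrAC.
rewrite (eq_integral (fun t => (2^-1)%:E * (\int[leb2 R]_x G (t, x)) +
    (c * V)%:E * (\1_(`[0%R, a]) t)%:E)); last first.
  by move=> t /set_mem Ot; exact: H.
have mI : measurable_fun (Otime +oo) (fun t => \int[leb2 R]_x G (t, x)).
  by apply: measurable_funTS; exact: measurable_integral_plane.
have ma : measurable (`[0%R, a]%classic : set (measurableTypeR R)).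
  exact: measurable_itv.
rewrite ge0_integralD//; last 4 first.
- by move=> t _; rewrite mule_ge0// integral_ge0.
- exact: measurable_funeM.
- by move=> t _; rewrite mule_ge0// lee_fin mulr_ge0.
- apply: measurable_funeM; apply/measurable_EFinP.
  exact: measurable_indic.
rewrite ge0_integralZl_EFin//; last first.
  by move=> t _; rewrite integral_ge0.
rewrite ge0_integralZl_EFin//; last 2 first.
- apply/measurable_EFinP; exact: measurable_indic.
- by rewrite mulr_ge0.
congr (_ + _).
  congr (_ * _); apply: eq_integral => t /set_mem Ot.
  by apply: eq_integral => x _; rewrite GF.
rewrite integral_indic//.
have -> : `[0%R, a]%classic `&` Otime +oo = `]0%R, a]%classic.
  rewrite Otime_itv; apply/seteqP; split=> t /=; rewrite !in_itv /= andbT.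
    by move=> [/andP[_ ->] ->].
  by move=> /andP[t0 ->]; rewrite t0 ltW.
have La : leb1 R `]0%R, a]%classic = a%:E.
  rewrite lebesgue_measure_itv /= lte_fin; case: ifPn => [_|].
    by rewrite -EFinB subr0.
  by rewrite -leNgt => a0'; congr (_%:E); apply/eqP; rewrite eq_le a0 a0'.
have -> : (c * a * V)%:E = (c * V)%:E * a%:E by rewrite -EFinM mulrAC.
by congr (_ * _); exact: La.
Qed.

(** Each of the integrals of [hA] and [hB] is at least minus half the energy minus [c * a * V]. The
    two halves cancel the energy in the identity, which leaves the bound on [i + j]. *)
Lemma energy_estimate (F hA hB : R -> plane -> R) (c a V : R) (K : set plane)
    (i j : \bar R) :
    measurable_fun (Otime +oo `*` setT)
      (fun z : measurableTypeR R * plane => F z.1 z.2) ->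
    (forall t x, (0 < t)%R -> (0 <= F t x)%R) ->
    (0 <= c)%R -> (0 <= a)%R -> measurable K -> leb2 R K = V%:E ->
    (forall t x, (0 < t)%R ->
      (`|hA t x| <= 2^-1 * F t x + c * (\1_(`[0%R, a]) t * \1_K x))%R) ->
    (forall t x, (0 < t)%R ->
      (`|hB t x| <= 2^-1 * F t x + c * (\1_(`[0%R, a]) t * \1_K x))%R) ->
    \int[leb1 R]_(t in Otime +oo) \int[leb2 R]_x (F t x)%:E + i + j
    + \int[leb1 R]_(t in Otime +oo) \int[leb2 R]_x (hA t x)%:E
    + \int[leb1 R]_(t in Otime +oo) \int[leb2 R]_x (hB t x)%:E = 0 ->
  i + j <= (2 * (c * a * V))%:E.
Proof.
move=> mF F0 c0 a0 mK KV hAF hBF.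
have E := integral_half_add_box mF F0 c0 a0 mK KV.
have lower (h : R -> plane -> R) :
    (forall t x, (0 < t)%R ->
      (`|h t x| <= 2^-1 * F t x + c * (\1_(`[0%R, a]) t * \1_K x))%R) ->
    - (\int[leb1 R]_(t in Otime +oo) \int[leb2 R]_x
      (2^-1 * F t x + c * (\1_(`[0%R, a]) t * \1_K x))%:E) <=
    \int[leb1 R]_(t in Otime +oo) \int[leb2 R]_x (h t x)%:E.
  move=> hF.
  have G0 t x : (0 < t)%R ->
      (0 <= 2^-1 * F t x + c * (\1_(`[0%R, a]) t * \1_K x))%R.
    by move=> t0; exact: le_trans (hF t x t0).
  apply: integral_ge_opp => t [t0 _].
    by apply: integral_ge0 => x _; rewrite lee_fin G0.
  apply: integral_ge_opp => x _; first by rewrite lee_fin G0.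
  rewrite -EFinN lee_fin; have := hF t x t0.
  by rewrite ler_norml => /andP[].
have := lower _ hBF; have := lower _ hAF; rewrite E {E lower}.
have : 0 <= \int[leb1 R]_(t in Otime +oo) \int[leb2 R]_x (F t x)%:E.
  by apply: integral_ge0 => t [t0 _]; apply: integral_ge0 => x _; rewrite lee_fin F0.
move: (\int[leb1 R]_(t in Otime +oo) \int[leb2 R]_x (F t x)%:E)
  (\int[leb1 R]_(t in Otime +oo) \int[leb2 R]_x (hA t x)%:E)
  (\int[leb1 R]_(t in Otime +oo) \int[leb2 R]_x (hB t x)%:E).
(* A single infinite term makes the whole sum infinite, as [+oo - oo = -oo]; the identity thus
   leaves only the case where all are finite. *)
move: i j => [i| |] [j| |] [f| |] [A| |] [B| |] //=.
rewrite -!EFinD !lee_fin => f0 lA lB [e].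
by move: lA lB e; lra.
Qed.

End Energy.

(** * Locally integrable functions and truncation of the integral of [f] *)

Section Exhaustion.
Context {R : realType}.
Local Notation plane := (measurableTypeR R * measurableTypeR R)%type.

Lemma compact_square n : compact (square n : set (R * R)).
Proof. by apply: compact_setX; exact: segment_compact. Qed.

(** Measurability holds on each compact square, and countably many squares cover the plane. *)
Lemma L1loc_measurable (f : R * R -> R) : L1loc f ->
  measurable_fun setT (f : plane -> R).
Proof.
move=> lf; rewrite -bigcup_square.
apply: (measurable_fun_bigcup _ (@measurable_square R)).2 => n.
by apply/measurable_EFinP; have /measurable_int := lf _ (@compact_square n).
Qed.

Lemma integrable_mul_compact_supp (f phi : R * R -> R) n : L1loc f ->
    measurable_fun setT (phi : plane -> R) -> (forall x, `|phi x| <= 1) ->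
    (forall x, ~ square n x -> phi x = 0) ->
  (leb2 R).-integrable setT (fun x => (f x * phi x)%:E).
Proof.
move=> lf mphi phi1 phi0.
have mf := L1loc_measurable lf.
have ms := @measurable_square R n.
have /(integrable_mkcond _ ms).1 := lf _ (@compact_square n).
apply: le_integrable => //.
  by apply/measurable_EFinP; exact: measurable_funM.
move=> x _; rewrite patchE; case: ifPn => xs.
  by rewrite /= lee_fin normrM ler_piMr.
by rewrite phi0 ?mulr0//; move: xs; rewrite notin_setE.
Qed.

(** The integral of [f] may be [+oo], so the two parts are treated separately: the truncated
    positive part converges by monotone convergence, while the truncated negative part never exceeds
    the full one. *)
Lemma integral_exhaustion (f : R * R -> R) (phi : nat -> R * R -> R) :
    measurable_fun setT (f : plane -> R) ->
    (forall n, measurable_fun setT (phi n : plane -> R)) ->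
    (forall n x, 0 <= phi n x <= 1) ->
    (forall x, {homo (phi ^~ x) : n m / (n <= m)%N >-> n <= m}) ->
    (forall x, phi n x @[n --> \oo] --> (1 : R)) ->
    (0 < \int[leb2 R]_x (f x)%:E)%E ->
  exists2 e : R, 0 < e &
    \forall n \near \oo, (e%:E <= \int[leb2 R]_x (f x * phi n x)%:E)%E.
Proof.
move=> mf mphi phi01 phi_nd phi_cvg; rewrite integralE => f0.
pose P n := (\int[leb2 R]_x (Num.max (f x) 0 * phi n x)%:E)%E.
pose Q n := (\int[leb2 R]_x (Num.max (- f x) 0 * phi n x)%:E)%E.
have PQ n : (\int[leb2 R]_x (f x * phi n x)%:E = P n - Q n)%E.
  rewrite integralE; congr (_ - _)%E; apply: eq_integral => x _;
    have /andP[p0 _] := phi01 n x.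
    by rewrite funeposE -EFin_max maxr_pMl// mul0r.
  by rewrite funenegE -EFin_max maxr_pMl// mul0r mulNr.
set Poo := (\int[leb2 R]_x _)%E in f0.
set Qoo := (\int[leb2 R]_x (fun z => (f z)%:E)^\- x)%E in f0.
have QQ n : (Q n <= Qoo)%E.
  apply: ge0_le_integral_nonmeasurable => x _; have /andP[p0 p1] := phi01 n x.
    by rewrite lee_fin mulr_ge0// le_max lexx orbT.
  by rewrite funenegE -EFin_max lee_fin ler_piMr// le_max lexx orbT.
have PP : P n @[n --> \oo] --> Poo.
  have mg n : measurable_fun setT
      (fun x : plane => (Num.max (f x) 0 * phi n x)%:E).
    apply/measurable_EFinP; apply: measurable_funM => //.
    exact: measurable_maxr.
  have g0 n (x : plane) : setT x -> (0 <= (Num.max (f x) 0 * phi n x)%:E)%E.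
    by move=> _; rewrite lee_fin mulr_ge0// ?le_max ?lexx ?orbT//;
      have /andP[] := phi01 n x.
  have nd (x : plane) : setT x -> {homo (fun n => (Num.max (f x) 0 * phi n x)%:E) :
      n m / (n <= m)%N >-> (n <= m)%E}.
    move=> _ n m nm; rewrite lee_fin ler_wpM2l ?le_max ?lexx ?orbT//.
    exact: phi_nd.
  have := @cvg_monotone_convergence _ plane _ (leb2 R) _ measurableT _ mg g0 nd.
  congr (_ --> _); apply: eq_integral => x _.
  apply/cvg_lim => //; rewrite funeposE -EFin_max.
  apply: cvg_EFin; first by near=> n.
  rewrite -[X in _ --> X]mulr1; apply: cvgM; first exact: cvg_cst.
  exact: phi_cvg.
have Q0 : (0 <= Qoo)%E by apply: integral_ge0 => x _; exact: funeneg_ge0.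
(* An infinite negative part would make the integral of [f] equal to [-oo], against its
   positivity. *)
have Qfin : Qoo \is a fin_num.
  rewrite ge0_fin_numE// ltey; apply/eqP => Qy; move: f0; rewrite Qy.
  by move: (Poo) => [p||].
(* Half of the gap serves when the positive part is finite, and 1 otherwise. *)
have [e e0 eP] : exists2 e : R, 0 < e & (Qoo + e%:E < Poo)%E.
  move: f0 Qfin; clear PP QQ Q0; case: Qoo => // q; case: Poo => [p||]//=.
    rewrite -EFinB lte_fin => pq _; exists ((p - q) / 2); first by rewrite divr_gt0.
    by rewrite -EFinD lte_fin; lra.
  by move=> _ _; exists 1 => //; rewrite -EFinD ltry.
exists e => //.
have Pev : \forall n \near \oo, (Qoo + e%:E < P n)%E := PP _ (open_ereal_gt' eP).
apply: filterS Pev => n; rewrite PQ => Pn.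
have Qn0 : (0 <= Q n)%E.
  apply: integral_ge0 => x _; have /andP[p0 _] := phi01 n x.
  by rewrite lee_fin mulr_ge0// le_max lexx orbT.
have := QQ n; move: Pn Qfin Qn0; clear Q0 f0 PQ QQ PP eP.
case: (P n) Qoo (Q n) => [a||] [b||] [c||] //=; last by rewrite leey.
by rewrite -EFinD -EFinB lte_fin !lee_fin; lra.
Unshelve. all: by end_near. Qed.

End Exhaustion.

(** * Young's inequality with a power weight *)

Section Estimates.
Context {R : realType}.
Local Notation plane := (measurableTypeR R * measurableTypeR R)%type.

(** Compare [2 * e] with [v]^ (p - 1) * b ^+ 2[. If it is smaller, multiplying by]v * b ^+
    m.+1[gives the first term on the right; otherwise]v * b ^+ m.+1[is at most](2 * e)
    [^ (p - 1)^-1], which gives the second. *)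
Lemma young_weighted (p b v e : R) m :
    1 < p -> 0 <= b <= 1 -> 0 <= v -> 0 < e -> 2 / (p - 1) <= m.+1%:R ->
  e * (v * b ^+ m.+1) <=
    2^-1 * (v `^ p * b ^+ m.+3) + (2 * e) `^ (p / (p - 1)).
Proof.
move=> p1 /andP[b0 b1] v0 e0 pm.
have p10 : 0 < p - 1 by rewrite subr_gt0.
have rhs0 : 0 <= 2^-1 * (v `^ p * b ^+ m.+3).
  by rewrite mulr_ge0 ?invr_ge0// mulr_ge0 ?powR_ge0 ?exprn_ge0.
have [->|bn0] := eqVneq b 0.
  by rewrite !expr0n /= !mulr0 add0r powR_ge0.
have [->|vn0] := eqVneq v 0.
  rewrite mul0r mulr0 addr_ge0 ?powR_ge0// mulr_ge0 ?invr_ge0//.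
  by rewrite mulr_ge0 ?powR_ge0 ?exprn_ge0.
have {}b0 : 0 < b by rewrite lt0r bn0.
have {}v0 : 0 < v by rewrite lt0r vn0.
have [le2e|lt2e] := leP (2 * e) (v `^ (p - 1) * b ^+ 2).
  apply: ler_wpDr; first exact: powR_ge0.
  have -> : v `^ p = v `^ (p - 1) * v.
    by rewrite mulrC mulr_powRB1 ?(ltW v0)// (lt_trans ltr01).
  have -> : e * (v * b ^+ m.+1) = 2^-1 * ((2 * e) * (v * b ^+ m.+1)) by field.
  rewrite ler_pM2l ?invr_gt0//.
  have -> : v `^ (p - 1) * v * b ^+ m.+3 =
      v `^ (p - 1) * b ^+ 2 * (v * b ^+ m.+1).
    by rewrite -[m.+3]/(2 + m.+1)%N exprD; ring.
  by rewrite ler_wpM2r// mulr_ge0 ?exprn_ge0// ltW.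
apply: ler_wpDl => //.
have -> : p / (p - 1) = 1 + (p - 1)^-1 by field; rewrite gt_eqF.
rewrite powRD; last by rewrite [2 * e == 0]gt_eqF ?mulr_gt0// implybT.
rewrite powRr1 ?mulr_ge0 ?(ltW e0)//.
have -> : 2 * e * (2 * e) `^ (p - 1)^-1 = e * (2 * (2 * e) `^ (p - 1)^-1) by ring.
rewrite ler_pM2l//.
apply: (@le_trans _ _ ((2 * e) `^ (p - 1)^-1)); last first.
  by rewrite ler_peMl ?powR_ge0// ler1n.
(* Since [b <= 1] and [(p - 1) * m.+1 >= 2], the inner power of [b] is at most [b ^+ 2]. *)
have -> : v * b ^+ m.+1 = (v `^ (p - 1) * b `^ ((p - 1) * m.+1%:R)) `^ (p - 1)^-1.
  rewrite powRM ?powR_ge0// -!powRrM mulfV ?gt_eqF// powRr1 ?(ltW v0)//.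
  by rewrite mulrAC mulfV ?gt_eqF// mul1r powR_mulrn// ltW.
apply: ge0_ler_powR; rewrite ?nnegrE ?invr_ge0 ?mulr_ge0 ?powR_ge0 ?ltW//.
apply: le_lt_trans lt2e.
rewrite ler_wpM2l ?powR_ge0// -powR_mulrn ?(ltW b0)//.
apply: ger_powR; first by rewrite b0.
by rewrite -ler_pdivrMl// mulrC.
Qed.
End Estimates.

(** * Lower bound for the source term, and measurability of the cutoffs *)

Section Assembly.
Context {R : realType}.
Local Notation plane := (measurableTypeR R * measurableTypeR R)%type.

(** [f] may change sign, but its integral against [phi] is at least [d >= 0]; the inner integral,
    [eta t] times that number, is thus nonnegative and at least [c * d] on []0, a]]. *)
Lemma source_term_ge (f phi : R * R -> R) (eta : R -> R) (a c d : R) :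
    (leb2 R).-integrable setT (fun x => (f x * phi x)%:E) ->
    0 <= a -> 0 <= c -> 0 <= d ->
    (d%:E <= \int[leb2 R]_x (f x * phi x)%:E)%E ->
    (forall t, 0 < t -> 0 <= eta t) ->
    (forall t, 0 < t -> t <= a -> c <= eta t) ->
  ((c * a * d)%:E <=
   \int[leb1 R]_(t in Otime +oo) \int[leb2 R]_x (f x * (eta t * phi x))%:E)%E.
Proof.
move=> fphi a0 c0 d0 df eta0 etac.
set I := (\int[leb2 R]_x (f x * phi x)%:E)%E in df.
have mO := @measurable_Otime R.
have ma : measurable (`]0, a]%classic : set (measurableTypeR R)).
  exact: measurable_itv.
have -> : (c * a * d)%:E =
    (\int[leb1 R]_(t in Otime +oo) ((c * d) * \1_(`]0%R, a]) t)%:E)%E.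
  under eq_integral do rewrite EFinM.
  rewrite ge0_integralZl_EFin//; last 2 first.
  - apply/measurable_EFinP; exact: measurable_indic.
  - exact: mulr_ge0.
  rewrite integral_indic//.
  have -> : `]0%R, a]%classic `&` Otime +oo = `]0%R, a]%classic.
    rewrite Otime_itv; apply/seteqP; split=> t /=; rewrite !in_itv /= andbT.
      by case.
    by move=> /andP[t0 ->]; rewrite t0.
  have La : leb1 R `]0%R, a]%classic = a%:E.
    rewrite lebesgue_measure_itv /= lte_fin; case: ifPn => [_|].
      by rewrite -EFinB subr0.
    by rewrite -leNgt => a0'; congr (_%:E); apply/eqP; rewrite eq_le a0 a0'.
  have -> : (c * a * d)%:E = ((c * d)%:E * a%:E)%E by rewrite -EFinM mulrAC.
  by congr (_ * _)%E; exact/esym.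
apply: ge0_le_integral_nonmeasurable => t [t0 _].
  by rewrite lee_fin mulr_ge0 ?mulr_ge0.
have -> : (\int[leb2 R]_x (f x * (eta t * phi x))%:E = (eta t)%:E * I)%E.
  rewrite -integralZl//; apply: eq_integral => x _.
  by rewrite -EFinM mulrCA.
rewrite indicE; case: (boolP (t \in _)) => [/set_mem/=|_].
  rewrite in_itv /= => /andP[_ ta]; rewrite mulr1 EFinM.
  apply: lee_pmul => //; rewrite ?lee_fin//.
  exact: etac.
by rewrite mulr0; apply: mule_ge0; [rewrite lee_fin eta0|exact: le_trans df].
Qed.

Lemma measurable_cutoff n (r : R) :
  measurable_fun setT (cutoff n r : measurableTypeR R -> R).
Proof. by apply: continuous_measurable_fun; exact: continuous_cutoff. Qed.

Lemma measurable_tensor (g h : R -> R) :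
    measurable_fun setT (g : measurableTypeR R -> R) ->
    measurable_fun setT (h : measurableTypeR R -> R) ->
  measurable_fun setT (tensor g h : plane -> R).
Proof.
move=> mg mh; apply: measurable_funM.
- exact: (measurableT_comp mg measurable_fst).
- exact: (measurableT_comp mh measurable_snd).
Qed.

Lemma cutoffS n (r s : R) : cutoff n r s = cutoff 1 r s ^+ n.
Proof. by rewrite cutoff_exp mul1n. Qed.

End Assembly.

(** * Pointwise bounds for the test function on the Grushin box *)

Section MainInequality.
Context {R : realType}.
Local Notation plane := (measurableTypeR R * measurableTypeR R)%type.

Definition box_cutoff k n (r : R) : R * R -> R :=
  tensor (cutoff n r) (cutoff n (r ^+ k.+1)).

(** The test function is the power [m.+3] of [base], which plays the role of [b] in
    [young_weighted]. *)
Definition base k (T r t : R) (x : R * R) : R := cutoff 1 T t * box_cutoff k 1 r x.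

Lemma base_exp k n (T r t : R) (x : R * R) :
  base k T r t x ^+ n = cutoff n T t * box_cutoff k n r x.
Proof. by rewrite /base /box_cutoff /tensor !exprMn -!cutoffS. Qed.

Lemma box_cutoff_ge0 k n (r : R) x : 0 <= box_cutoff k n r x.
Proof. by rewrite mulr_ge0 ?cutoff_ge0. Qed.

Lemma box_cutoff_le1 k n (r : R) x : box_cutoff k n r x <= 1.
Proof. by rewrite mulr_ile1 ?cutoff_ge0 ?cutoff_le1. Qed.

Lemma box_cutoff_antimono k n n' (r : R) x : (n <= n')%N ->
  box_cutoff k n' r x <= box_cutoff k n r x.
Proof. by move=> nn'; rewrite ler_pM ?cutoff_ge0// cutoff_antimono. Qed.

(** The constant 8 is twice the 4 of [normr_cutoff2_le], one for each square in the Grushin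
    operator; it also covers the time derivative. *)
Definition cutoff_rate m (r : R) : R := 8 * m.+3%:R ^+ 2 / r ^+ 2.

(** The parabolic condition [r ^+ 2 <= T] converts the rate [1 / T] of the time cutoff into
    [r ^- 2]. *)
Lemma normr_dt_le k m (T r t : R) (x : R * R) : 0 < r -> r ^+ 2 <= T ->
  `|cutoff1 m T t * box_cutoff k m.+3 r x| <= cutoff_rate m r * base k T r t x ^+ m.+1.
Proof.
move=> r0 rT; have r2 : 0 < r ^+ 2 by rewrite exprn_gt0.
have T0 : 0 < T by exact: lt_le_trans rT.
rewrite base_exp [leRHS]mulrA normrM (ger0_norm (box_cutoff_ge0 _ _ _ _)).
apply: ler_pM => //; first exact: box_cutoff_ge0; last first.
  exact: box_cutoff_antimono (leqW (leqnSn _)).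
apply: le_trans (normr_cutoff1_le m t T0) _.
apply: ler_pM.
- by rewrite divr_ge0// ltW.
- exact: cutoff_ge0.
- rewrite /cutoff_rate ler_pM ?invr_ge0 ?(ltW T0)//.
  + have : 1 <= m.+3%:R :> R by rewrite ler1n.
    by move: (m.+3%:R : R) => N; nra.
  + by rewrite lef_pV2.
- exact: cutoff_antimono.
Qed.

(** In the support [x.1 ^+ k * x.1 ^+ k <= r ^+ (2 * k)], and against the factor [r ^- (2 * k.+1)]
    from the width [r ^+ k.+1] this leaves [r ^- 2], as for the first square. *)
Lemma normr_laplacian_le k m (T r t : R) (x : R * R) : 0 < r ->
  `|cutoff m.+3 T t * (cutoff2 m r x.1 * cutoff m.+3 (r ^+ k.+1) x.2 +
     x.1 ^+ k * x.1 ^+ k *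
     (cutoff m.+3 r x.1 * cutoff2 m (r ^+ k.+1) x.2))| <=
  cutoff_rate m r * base k T r t x ^+ m.+1.
Proof.
move=> r0; have rk0 : 0 < r ^+ k.+1 by rewrite exprn_gt0.
pose M : R := 4 * m.+3%:R ^+ 2 / r ^+ 2.
have M0 : 0 <= M by rewrite divr_ge0// exprn_ge0// ltW.
rewrite base_exp normrM (ger0_norm (cutoff_ge0 _ _ _)) [leRHS]mulrCA.
apply: ler_pM => //; [exact: cutoff_ge0|exact: cutoff_antimono (leqW (leqnSn _))|].
have -> : cutoff_rate m r * box_cutoff k m.+1 r x =
    M * box_cutoff k m.+1 r x + M * box_cutoff k m.+1 r x.
  by rewrite -mulrDl /cutoff_rate /M; congr (_ * _); ring.
apply: le_trans (ler_normD _ _) _; apply: lerD.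
  rewrite normrM /box_cutoff /tensor mulrA.
  apply: ler_pM => //; first exact: normr_cutoff2_le.
  by rewrite ger0_norm ?cutoff_ge0//; exact: cutoff_antimono (leqW (leqnSn _)).
have -> : M * box_cutoff k m.+1 r x = (r ^+ k * r ^+ k * cutoff m.+1 r x.1) *
    (4 * m.+3%:R ^+ 2 / (r ^+ k.+1) ^+ 2 * cutoff m.+1 (r ^+ k.+1) x.2).
  rewrite /M /box_cutoff /tensor; have : r ^+ k != 0 by rewrite expf_neq0 ?gt_eqF.
  move: (cutoff _ _ x.1) (cutoff _ _ x.2) => A B.
  by rewrite [r ^+ k.+1]exprS; move: (r ^+ k) => D D0; field; rewrite D0 gt_eqF.
rewrite mulrA normrM; apply: ler_pM => //; last exact: normr_cutoff2_le.
have [rx|xr] := leP r `|x.1|.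
  by rewrite !cutoff_eq0// !mulr0 normr0.
rewrite normrM (ger0_norm (cutoff_ge0 _ _ _)); apply: ler_pM => //.
- exact: cutoff_ge0.
- rewrite normrM normrX; apply: ler_pM; rewrite ?exprn_ge0//;
    by rewrite lerXn2r// ?nnegrE ?(ltW r0)// ltW.
- exact: cutoff_antimono (leqW (leqnSn _)).
Qed.

Lemma base_eq0 k (T r t : R) (x : R * R) : 0 < r -> 0 < T -> 0 < t ->
    \1_(`[0, T]%classic) t *
    \1_(`[- r, r]%classic `*` `[- r ^+ k.+1, r ^+ k.+1]%classic) x = 0 :> R ->
  base k T r t x = 0.
Proof.
move=> r0 T0 t0; have rk0 : 0 < r ^+ k.+1 by rewrite exprn_gt0.
rewrite /base /box_cutoff /tensor.
have [tT|Tt] := leP t T; last first.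
  by rewrite (@cutoff_eq0 _ 0 T)// ?mul0r// gtr0_norm// ltW.
have [x1|x1] := leP `|x.1| r; last by rewrite (@cutoff_eq0 _ 0 r) ?mul0r ?mulr0// ltW.
have [x2|x2] := leP `|x.2| (r ^+ k.+1); last first.
  by rewrite (@cutoff_eq0 _ 0 (r ^+ k.+1)) ?mulr0// ltW.
rewrite !indicE !mem_set ?mulr1; last 2 first.
- by split; rewrite /= in_itv /= -ler_norml.
- by rewrite /= in_itv /= (ltW t0).
by move/eqP; rewrite oner_eq0.
Qed.

(** On the box this is [young_weighted]; off the box [base], and with it [a], vanishes. The constant
    is therefore paid only on a set of finite measure. *)
Lemma young_base k m (p T r t v a : R) (x : R * R) :
    1 < p -> 2 / (p - 1) <= m.+1%:R -> 0 < r -> 0 < T -> 0 < t ->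
    `|a| <= cutoff_rate m r * base k T r t x ^+ m.+1 ->
  `|v * a| <= 2^-1 * (`|v| `^ p * (cutoff m.+3 T t * box_cutoff k m.+3 r x)) +
    (2 * cutoff_rate m r) `^ (p / (p - 1)) *
    (\1_(`[0, T]%classic) t *
     \1_(`[- r, r]%classic `*` `[- r ^+ k.+1, r ^+ k.+1]%classic) x).
Proof.
move=> p1 pm r0 T0 t0 ae.
have e0 : 0 < cutoff_rate m r by rewrite divr_gt0 ?mulr_gt0 ?exprn_gt0.
set I := \1_(`[0, T]%classic) t * _.
have [I0|I1] : I = 0 \/ I = 1.
  by rewrite /I !indicE; do 2 case: (_ \in _); rewrite ?mulr0 ?mul0r ?mulr1; auto.
  move: ae; rewrite (base_eq0 r0 T0 t0 I0) expr0n mulr0 normr_le0 => /eqP ->.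
  rewrite mulr0 normr0 I0 mulr0 addr0 mulr_ge0 ?invr_ge0// mulr_ge0 ?powR_ge0//.
  by rewrite mulr_ge0 ?cutoff_ge0 ?box_cutoff_ge0.
rewrite I1 mulr1 -base_exp normrM.
apply: le_trans (young_weighted _ _ _ _ pm) => //.
  by rewrite mulrCA ler_wpM2l.
rewrite mulr_ge0 ?cutoff_ge0 ?box_cutoff_ge0//=.
by rewrite mulr_ile1 ?cutoff_ge0 ?box_cutoff_ge0 ?cutoff_le1 ?box_cutoff_le1.
Qed.

End MainInequality.

(** * The weak formulation at finite [r] and [T] *)

Section Conclusion.
Context {R : realType}.
Local Notation plane := (measurableTypeR R * measurableTypeR R)%type.

Lemma measurable_box_cutoff k n (r : R) :
  measurable_fun setT (box_cutoff k n r : plane -> R).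
Proof. by apply: measurable_tensor; exact: measurable_cutoff. Qed.

Lemma leb2_box (a b : R) : 0 <= a -> 0 <= b ->
  leb2 R (`[- a, a]%classic `*` `[- b, b]%classic) = (4 * (a * b))%:E.
Proof.
move=> a0 b0.
have L (c : R) : 0 <= c -> leb1 R `[- c, c]%classic = (2 * c)%:E.
  move=> c0; rewrite lebesgue_measure_itv /= lte_fin; case: ifPn => [_|].
    by rewrite -EFinB; congr (_%:E); lra.
  by rewrite -leNgt => cc; congr (_%:E); lra.
rewrite product_measure1E; do ?exact: measurable_itv.
transitivity ((2 * a)%:E * (2 * b)%:E)%E.
  by congr (_ * _)%E; exact: L.
by rewrite -EFinM; congr (_%:E); ring.
Qed.

Lemma box_cutoff_support k n (r : R) N x : 0 < r -> r <= N%:R -> r ^+ k.+1 <= N%:R ->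
  ~ square N x -> box_cutoff k n.+1 r x = 0.
Proof.
move=> r0 rN rkN nx; have rk0 : 0 < r ^+ k.+1 by rewrite exprn_gt0.
rewrite /box_cutoff /tensor.
have [x1|x1] := leP `|x.1| r; last by rewrite cutoff_eq0 ?mul0r// ltW.
have [x2|x2] := leP `|x.2| (r ^+ k.+1); last first.
  by rewrite (@cutoff_eq0 _ _ (r ^+ k.+1)) ?mulr0// ltW.
by exfalso; apply: nx; split; rewrite /= in_itv /= -ler_norml;
  [exact: le_trans rN|exact: le_trans rkN].
Qed.

Lemma integrable_mul_box_cutoff k n (r : R) (f : R * R -> R) : 0 < r -> L1loc f ->
  (leb2 R).-integrable setT (fun x => (f x * box_cutoff k n.+1 r x)%:E).
Proof.
move=> r0 lf; pose N := Num.bound (Num.max r (r ^+ k.+1)).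
have : Num.max r (r ^+ k.+1) <= N%:R.
  by apply/ltW/archi_boundP; rewrite le_max ltW.
rewrite ge_max => /andP[rN rkN].
apply: (integrable_mul_compact_supp lf (n := N)).
- exact: measurable_box_cutoff.
- by move=> x; rewrite ger0_norm ?box_cutoff_ge0 ?box_cutoff_le1.
- by move=> x; exact: box_cutoff_support.
Qed.

(** [energy_estimate] is applied to the product cutoff; [4 * (r * r ^+ k.+1)] is the area of its
    spatial support. *)
Lemma weak_solution_bound k m (p : R) (u0 f : R * R -> R) u (r T d : R) :
    1 < p -> 2 / (p - 1) <= m.+1%:R -> 0 < r -> r ^+ 2 <= T ->
    L1loc f -> 0 <= d ->
    (d%:E <= \int[leb2 R]_x (f x * box_cutoff k m.+3 r x)%:E)%E ->
    global_weak_solution [:: grushin1; grushin2 k] p f u0 u ->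
  (\int[leb2 R]_x (u0 x * box_cutoff k m.+3 r x)%:E +
    ((3 / 4) ^+ m.+3 * (T / 2) * d)%:E <=
   (2 * ((2 * cutoff_rate m r) `^ (p / (p - 1)) * T * (4 * (r * r ^+ k.+1))))%:E)%E.
Proof.
move=> p1 pm r0 rT lf d0 fd [[mu _] weak].
have T0 : 0 < T by rewrite (lt_le_trans _ rT)// exprn_gt0.
have rk0 : 0 < r ^+ k.+1 by rewrite exprn_gt0.
have [Mt bt] := C2_bounded_cutoff m T0.
have [M1 b1] := C2_bounded_cutoff m r0.
have [M2 b2] := C2_bounded_cutoff m rk0.
have cut0 (a s : R) : 0 < a -> a < `|s| -> cutoff m.+3 a s = 0.
  by move=> a0 /ltW; exact: cutoff_eq0.
pose psi t x := cutoff m.+3 T t * box_cutoff k m.+3 r x.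
have test : test_function +oo psi.
  apply: (@test_function_tensor _ r (r ^+ k.+1) T _ _ _ _ _ _ _ _ _ _ _ _
    bt b1 b2).
  - by move=> t Tt; rewrite cut0// gtr0_norm// (lt_trans T0).
  - by move=> s; exact: cut0.
  - by move=> s; exact: cut0.
have psi0 (t : R) x : Itime (+oo : \bar R) t -> 0 <= psi t x.
  by move=> _; rewrite mulr_ge0 ?cutoff_ge0 ?box_cutoff_ge0.
have dt (x : R * R) t :
    derive1 (psi ^~ x) t = cutoff1 m T t * box_cutoff k m.+3 r x.
  rewrite derive1E.
  have -> : psi ^~ x = box_cutoff k m.+3 r x \*: cutoff m.+3 T.
    by apply/funext => s; rewrite /psi /= mulrC.
  by have := C2b_derive bt t => bt'; rewrite derive_val /GRing.scale /= mulrC.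
have := weak _ test psi0.
set I2 := (\int[leb2 R]_x (u0 x * _)%:E)%E.
set I3 := (\int[leb1 R]_(t in _) \int[leb2 R]_x (f x * _)%:E)%E.
move=> weakE.
have := @energy_estimate R (fun t x => `|u t x| `^ p * psi t x)
  (fun t x => u t x * derive1 (psi ^~ x) t)
  (fun t x => u t x * vf_laplacian [:: grushin1; grushin2 k] (psi t) x)
  ((2 * cutoff_rate m r) `^ (p / (p - 1))) T (4 * (r * r ^+ k.+1))
  (`[- r, r]%classic `*` `[- r ^+ k.+1, r ^+ k.+1]%classic) I2 I3.
move=> H; apply: le_trans (H _ _ _ _ _ _ _ _ weakE); rewrite {H}.
- apply: leeD.
    rewrite le_eqVlt; apply/orP; left; apply/eqP; apply: eq_integral => x _.
    rewrite /psi; have -> : cutoff m.+3 T 0 = 1; last by rewrite mul1r.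
    by rewrite /cutoff mul0r expr0n subr0 max_r ?expr1n.
  apply: source_term_ge => //.
  + exact: integrable_mul_box_cutoff.
  + by rewrite divr_ge0// ltW.
  + by move=> t _; exact: cutoff_ge0.
  (* For [t <= T / 2] the base of the time cutoff is at least [1 - (1 / 2) ^+ 2 = 3 / 4]. *)
  + move=> t t0 tT; rewrite cutoffS lerXn2r ?nnegrE ?cutoff_ge0//.
    rewrite /cutoff expr1 le_max; apply/orP; right.
    have : (t / T) ^+ 2 <= (1 / 2) ^+ 2.
      rewrite lerXn2r ?nnegrE ?divr_ge0 ?(ltW t0) ?(ltW T0)//.
      by rewrite ler_pdivrMr// mulrC mul1r.
    by lra.
- apply: measurable_funM.
    apply: (measurableT_comp (measurable_powR p)).
    exact: (measurableT_comp (@normr_measurable R setT) mu).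
  apply: measurable_funTS; apply: measurable_funM.
    exact: (measurableT_comp (@measurable_cutoff R _ _) measurable_fst).
  exact: (measurableT_comp (@measurable_box_cutoff _ _ _) measurable_snd).
- by move=> t x _; rewrite mulr_ge0 ?powR_ge0// mulr_ge0 ?cutoff_ge0 ?box_cutoff_ge0.
- exact: powR_ge0.
- exact: ltW.
- by apply: measurableX; exact: measurable_itv.
- by apply: leb2_box; exact: ltW.
- move=> t x t0; apply: (young_base _ p1 pm) => //.
  by rewrite dt; exact: normr_dt_le.
- move=> t x t0; apply: (young_base _ p1 pm) => //.
  by rewrite (vf_laplacian_grushin _ _ _ b1 b2); exact: normr_laplacian_le.
Qed.

End Conclusion.

(** * Behaviour of the cutoffs and of the constants as the radius grows *)

Section Limits.
Context {R : realType}.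
Local Notation plane := (measurableTypeR R * measurableTypeR R)%type.

(** By scaling this is [cutoff n 1] evaluated at points tending to 0, where it is continuous with
    value 1. *)
Lemma cvg_cutoff n j (s : R) : cutoff n (i.+1%:R ^+ j.+1) s @[i --> \oo] --> (1 : R).
Proof.
have -> : (fun i => cutoff n (i.+1%:R ^+ j.+1) s) =
    cutoff n 1 \o (fun i => s * (harmonic i) ^+ j.+1).
  by apply/funext => i; rewrite /cutoff /harmonic /= divr1 exprVn.
have c01 : cutoff n (1 : R) 0 = 1.
  by rewrite /cutoff mul0r expr0n subr0 max_r ?expr1n.
rewrite -[X in _ --> X]c01.
apply: (@cvg_comp _ _ _ _ (cutoff n 1) _ (nbhs (0 : R))); last exact: continuous_cutoff.
have -> : (0 : R) = s * 0 ^+ j.+1 by rewrite expr0n mulr0.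
apply: cvgM; first exact: cvg_cst.
apply: (@cvg_comp _ _ _ _ (fun x => x ^+ j.+1) _ (nbhs (0 : R))).
  exact: cvg_harmonic.
exact: exprn_continuous.
Qed.

Lemma cvg_box_cutoff k n x : box_cutoff k n (i.+1%:R : R) x @[i --> \oo] --> (1 : R).
Proof.
rewrite /box_cutoff /tensor -[X in _ --> X]mulr1; apply: cvgM.
  exact: (@cvg_cutoff n 0).
exact: cvg_cutoff.
Qed.

Lemma box_cutoff_nd k n x : {homo (fun i => box_cutoff k n (i.+1%:R : R) x) :
  i j / (i <= j)%N >-> i <= j}.
Proof.
move=> i j ij.
have ij' : i.+1%:R <= j.+1%:R :> R by rewrite ler_nat ltnS.
apply: ler_pM; rewrite ?cutoff_ge0 ?le_cutoff ?exprn_gt0//.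
by rewrite lerXn2r// nnegrE.
Qed.

Lemma powR_natr_large (s C : R) : 0 < s ->
  \forall n \near \oo, C < (n.+1%:R : R) `^ s.
Proof.
move=> s0; pose N := Num.bound (`|C| `^ s^-1).
exists N => // n /= Nn; apply: (le_lt_trans (ler_norm C)).
have -> : `|C| = (`|C| `^ s^-1) `^ s by rewrite -powRrM mulVf ?gt_eqF// powRr1.
apply: gt0_ltr_powR; rewrite ?nnegrE ?powR_ge0//.
apply: (@lt_le_trans _ _ N%:R); first by apply: archi_boundP; exact: powR_ge0.
by rewrite ler_nat (leq_trans Nn).
Qed.

(** With [q = p / (p - 1)], the power of the rate scales as [r^(-2q)] and the area as [r^(k+2)]; the
    last factor on the left compensates both exactly. *)
Lemma cutoff_rate_powR k m (p r : R) : 1 < p -> 0 < r ->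
  (2 * cutoff_rate m r) `^ (p / (p - 1)) * (4 * (r * r ^+ k.+1)) *
    r `^ (2 * (p / (p - 1)) - (k + 2)%:R) =
  4 * (16 * m.+3%:R ^+ 2) `^ (p / (p - 1)).
Proof.
move=> p1 r0; set q := p / (p - 1); pose D : R := 16 * m.+3%:R ^+ 2.
have D0 : 0 <= D by rewrite mulr_ge0.
have r0' : r != 0 by rewrite gt_eqF.
have -> : 2 * cutoff_rate m r = D * r `^ (- 2).
  by rewrite powR_invn ?ltW// /cutoff_rate /D; field.
rewrite powRM ?powR_ge0// -powRrM -exprS.
have -> : r ^+ k.+2 = r `^ (k + 2)%:R by rewrite addn2 powR_mulrn// ltW.
have -> : D `^ q * r `^ (- 2 * q) * (4 * r `^ (k + 2)%:R) *
    r `^ (2 * q - (k + 2)%:R) =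
  4 * D `^ q * (r `^ (- 2 * q) * r `^ (k + 2)%:R * r `^ (2 * q - (k + 2)%:R)) by ring.
rewrite -!powRD ?r0' ?implybT//.
have -> : - 2 * q + (k + 2)%:R + (2 * q - (k + 2)%:R) = 0 by ring.
by rewrite powRr0 mulr1.
Qed.

End Limits.

Theorem corollary4p11 (R : realType) (k : nat) (p : R) (u0 f : R * R -> R) :
  (0 < k)%N ->
  1 < p -> p < (k + 2)%:R / k%:R ->
  L1loc u0 ->
  L1loc f ->
  (0 < \int[leb2 R]_x (f x)%:E)%E ->
  ~ exists u : R -> R * R -> R,
      global_weak_solution [:: grushin1; grushin2 k] p f u0 u.
Proof.
move=> k0 p1 pk lu0 lf f0 [u sol].
have p10 : 0 < p - 1 by rewrite subr_gt0.
(* Then the exponent [m.+3] of the cutoff is at least [2 + 2 / (p - 1) = 2p / (p - 1)]. *)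
pose m := Num.bound (2 / (p - 1)).
have pm : 2 / (p - 1) <= m.+1%:R.
  apply/ltW/(lt_le_trans (archi_boundP _)); first by rewrite divr_ge0// ltW.
  by rewrite ler_nat.
set q := p / (p - 1).
(* After clearing denominators, [2p > (k + 2)(p - 1)] reads [k p < k + 2]. *)
have s0 : 0 < 2 * q - (k + 2)%:R.
  rewrite subr_gt0 /q mulrA ltr_pdivlMr//.
  have kR : 0 < k%:R :> R by rewrite ltr0n.
  by move: pk; rewrite ltr_pdivlMr// natrD; nra.
have [e e0 fe] : exists2 e : R, 0 < e & \forall n \near \oo,
    (e%:E <= \int[leb2 R]_x (f x * box_cutoff k m.+3 n.+1%:R x)%:E)%E.
  apply: (integral_exhaustion (L1loc_measurable lf)) => //.
  - by move=> n; exact: measurable_box_cutoff.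
  - by move=> n x; rewrite box_cutoff_ge0 box_cutoff_le1.
  - by move=> x; exact: box_cutoff_nd.
  - by move=> x; exact: cvg_box_cutoff.
pose c : R := (3 / 4) ^+ m.+3.
have c0 : 0 < c by rewrite exprn_gt0.
have ce0 : 0 < c * e by rewrite mulr_gt0.
pose C := 4 * (16 * m.+3%:R ^+ 2) `^ q : R.
(* The radius is fixed before [T], large enough both for the truncated integral of [f] to stay above
   [e] and for the coefficient [A] of [T] to fall below [c * e / 8]. *)
have [n [fn Cn]] : exists n, (e%:E <=
    \int[leb2 R]_x (f x * box_cutoff k m.+3 n.+1%:R x)%:E)%E /\
    8 * C / (c * e) < (n.+1%:R : R) `^ (2 * q - (k + 2)%:R).
  have [N _ HN] := filterI fe (powR_natr_large (8 * C / (c * e)) s0).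
  by exists N; apply: HN => /=.
pose r : R := n.+1%:R; have r0 : 0 < r by [].
pose A := (2 * cutoff_rate m r) `^ q * (4 * (r * r ^+ k.+1)).
have Ar : A < c * e / 8.
  have := cutoff_rate_powR k m p1 r0; rewrite -/q -/A -/C => AC.
  have rs0 : 0 < r `^ (2 * q - (k + 2)%:R) by exact: powR_gt0.
  rewrite -(ltr_pM2r rs0) AC; move: Cn; rewrite ltr_pdivrMr// -/r.
  by move: (r `^ _) => y; lra.
have Ufin := integrable_fin_num measurableT (integrable_mul_box_cutoff k m.+2 r0 lu0).
have bound T : r ^+ 2 <= T -> fine (\int[leb2 R]_x (u0 x * box_cutoff k m.+3 r x)%:E) +
    c * (T / 2) * e <= 2 * (A * T).
  move=> rT; rewrite -lee_fin EFinD fineK//.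
  have := weak_solution_bound p1 pm r0 rT lf (ltW e0) fn sol.
  congr (_ <= _)%E; congr (_%:E); rewrite /A -/q; ring.
move: bound; move: (fine _) => U bound.
(* Since [2 * A * T < c * e * T / 4], the bound yields [c * e * T / 4 < - U]. The second summand
   makes the left side at least [|U| + 1], a contradiction; the first ensures [r ^+ 2 <= T]. *)
pose T := r ^+ 2 + 4 * (`|U| + 1) / (c * e).
have rT : r ^+ 2 <= T by rewrite lerDl divr_ge0 ?ltW// mulr_gt0// ltr_wpDl.
have T0 : 0 < T by rewrite (lt_le_trans _ rT) ?exprn_gt0.
have UT : 4 * (`|U| + 1) <= c * e * T.
  rewrite /T [leRHS]mulrDr [c * e * (_ / _)]mulrC divfK ?(gt_eqF ce0)//.
  by rewrite lerDr mulr_ge0 ?(ltW ce0) ?exprn_ge0 ?(ltW r0).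
have UN : - `|U| <= U by have := ler_norm (- U); rewrite normrN; lra.
have AT : A * T < c * e / 8 * T by rewrite ltr_pM2r.
by have := bound T rT; lra.
Qed.
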